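(* Let $\alpha\colon\mathbb{N}\to\mathbb{N}$. The following conditions are equivalent. (i) For all $n,n',k\in\mathbb{N}$: $\alpha(\alpha(n))=\alpha(n)$, and $\alpha(n)=\alpha(n')$ implies $\alpha(n+k)=\alpha(n'+k)$. (ii) Either $\alpha$ is the identity function on $\mathbb{N}$ or there exist integers $n_1\geq 0$ and $\ell>0$ such that (a) $\alpha(n)=n$ whenever $0\leq n<n_1$, (b) $\alpha$ is $(n_1,\ell)$-periodic, (c) $\alpha(n)\geq n$ and $\alpha(n)\equiv n\pmod{\ell}$ whenever $n_1\leq n<n_1+\ell$. In addition, $\alpha$ satisfies the condition ''for all $n\in\mathbb{N}$, $\alpha(n)=0$ if and only if $n=0$'' if and only if $\alpha$ is the identity function on $\mathbb{N}$ or $\alpha$ satisfies conditions (a)–(c) with $n_1>0$ (for some integers $n_1>0$ and $\ell>0$).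
   Context: $\mathbb{N}$ is the set of nonnegative integers. A function $\alpha\colon\mathbb{N}\to\mathbb{N}$ is $(n_1,p)$-periodic if $\alpha(n)=\alpha(n+p)$ for all $n\geq n_1$.
   Formalization: The ''In addition'' equivalence is stated for α satisfying condition (i); for arbitrary α it is false, e.g. α(0)=0 and α(n)=n+1 for n>0 satisfies the zero condition but is neither the identity nor periodic from any point. *)

(* Defs.v *)
From mathcomp Require Import all_boot.

Set Implicit Arguments.
Unset Strict Implicit.
Unset Printing Implicit Defensive.

Definition periodic (n1 p : nat) (alpha : nat -> nat) : Prop :=
  forall n, n1 <= n -> alpha n = alpha (n + p).

Definition idempotent_shift_stable (alpha : nat -> nat) : Prop :=
  forall n n' k : nat,
    alpha (alpha n) = alpha n /\
    (alpha n = alpha n' -> alpha (n + k) = alpha (n' + k)).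

Definition is_identity (alpha : nat -> nat) : Prop := forall n, alpha n = n.

Definition conditions_abc (n1 l : nat) (alpha : nat -> nat) : Prop :=
  [/\ forall n, n < n1 -> alpha n = n,
      periodic n1 l alpha
    & forall n, n1 <= n < n1 + l -> n <= alpha n /\ alpha n = n %[mod l]].

(* Main.v *)
Require Import Defs.
From mathcomp Require Import all_boot.
From mathcomp Require Import zify.
From Stdlib Require Import Classical.

Set Implicit Arguments.
Unset Strict Implicit.
Unset Printing Implicit Defensive.

(** Condition (i) says that the fibres of [alpha] form a congruence on the
    monoid (nat, +) and that [alpha] selects a point in each fibre.  A
    nontrivial congruence on (nat, +) has an index [n1], the least number
    congruent to a larger one, and a period [l], the least positive number with
    [n1] congruent to [n1 + l]; two numbers at least [n1] are then congruent
    iff they agree mod [l]. *)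

(** Strong induction on a witness; excluded middle decides whether a smaller one exists, since [P]
    need not be decidable. *)
Lemma least_element (P : nat -> Prop) :
  (exists n, P n) -> exists2 n, P n & forall m, P m -> n <= m.
Proof.
case=> n; elim/ltn_ind: n => n IH Pn.
have [[m ltmn Pm]|noP] := classic (exists2 m, m < n & P m); first exact: IH Pm.
exists n => // m Pm; rewrite leqNgt; apply/negP => ltmn.
by apply: noP; exists m.
Qed.

Section Periodic.

Variables (n1 l : nat) (alpha : nat -> nat).
Hypothesis alpha_per : periodic n1 l alpha.

Lemma periodic_mul k n : n1 <= n -> alpha (n + k * l) = alpha n.
Proof.
move=> le_n1n; elim: k => [|k IH]; first by rewrite mul0n addn0.
by rewrite mulSn addnCA addnC -alpha_per ?IH // (leq_trans le_n1n) ?leq_addr.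
Qed.

Lemma periodic_eqmod m n :
  n1 <= m -> n1 <= n -> m = n %[mod l] -> alpha m = alpha n.
Proof.
wlog le_mn : m n / m <= n => [hw|] le_n1m le_n1n eq_mn.
  by case/orP: (leq_total m n) => le; [apply: hw | symmetry; apply: hw].
have /dvdnP[k Dk] : l %| n - m by rewrite -eqn_mod_dvd // eq_mn.
by rewrite -(subnKC le_mn) Dk periodic_mul.
Qed.

Lemma periodic_reduce n :
  n1 <= n -> alpha n = alpha (n1 + (n - n1) %% l).
Proof.
move=> le_n1n; apply: periodic_eqmod; rewrite ?leq_addr //.
by rewrite modnDmr subnKC.
Qed.

End Periodic.

Section Sufficiency.

Variables (n1 l : nat) (alpha : nat -> nat).
Hypotheses (l_gt0 : 0 < l) (abc : conditions_abc n1 l alpha).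

(** Periodicity carries [n] to its representative in the window from [n1] to [n1 + l - 1], where (c)
    applies. *)
Lemma abc_tail n : n1 <= n -> n1 <= alpha n /\ alpha n = n %[mod l].
Proof.
case: abc => _ per tail le_n1n; rewrite (periodic_reduce per) //.
have [|le_a eq_a] := tail (n1 + (n - n1) %% l).
  by rewrite leq_addr ltn_add2l ltn_pmod.
split; first exact: leq_trans (leq_addr _ _) le_a.
by rewrite eq_a modnDmr subnKC.
Qed.

Lemma abc_lt n : (alpha n < n1) = (n < n1).
Proof.
case: abc => fix_lt _ _; case: (ltnP n n1) => [lt|/abc_tail[le _]].
  by rewrite fix_lt.
by rewrite ltnNge le.
Qed.

(** From [n1] on, [alpha n] and [n] are congruent mod [l], so periodicity gives idempotence. Equal
    values place both arguments on the same side of [n1]: below it they coincide, otherwise they are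
    congruent mod [l], and so are their shifts. *)
Lemma abc_idempotent_shift_stable : idempotent_shift_stable alpha.
Proof.
have [fix_lt per _] := abc => n n' k; split.
  have [lt|le] := ltnP n n1; first by rewrite !fix_lt.
  have [le_a eq_a] := abc_tail le.
  exact: periodic_eqmod per _ _ le_a le eq_a.
move=> eq_a; have := abc_lt n; rewrite eq_a abc_lt.
have [lt|le] := ltnP n n1 => [lt'|/negbT]; last rewrite -leqNgt => le'.
  by move: eq_a; rewrite (fix_lt n) ?(fix_lt n') // => ->.
have [_ eq_n] := abc_tail le; have [_ eq_n'] := abc_tail le'.
apply: (periodic_eqmod per); rewrite ?(leq_trans _ (leq_addr _ _)) //.
by apply/eqP; rewrite eqn_modDr -eq_n -eq_n' eq_a.
Qed.

Lemma abc_eq0 : 0 < n1 -> forall n, alpha n = 0 <-> n = 0.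
Proof.
case: abc => fix_lt _ _ n1_gt0 n; split=> [a0|->]; last exact: fix_lt.
by rewrite -[n]fix_lt // -abc_lt a0.
Qed.

End Sufficiency.

Lemma idempotent_shift_stable_abc (alpha : nat -> nat) :
  idempotent_shift_stable alpha -> ~ is_identity alpha ->
  exists n1 l : nat, 0 < l /\ conditions_abc n1 l alpha.
Proof.
move=> stable nid.
have idem n : alpha (alpha n) = alpha n by have [] := stable n n 0.
have shift k n n' : alpha n = alpha n' -> alpha (n + k) = alpha (n' + k).
  by have [] := stable n n' k.
pose collapses n := exists2 n', n < n' & alpha n = alpha n'.
have [n1 [n' lt_n1n' eq_n1n'] n1_min] : exists2 n, collapses n
    & forall m, collapses m -> n <= m.
  (* By idempotence [n] and [alpha n] have the same value, so the smaller of the two collapses. *)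
  apply: least_element; have [n nfix] := not_all_ex_not _ _ nid.
  have [lt|lt|eq_n] := ltngtP n (alpha n); last by case: nfix.
    by exists n, (alpha n).
  by exists (alpha n), n.
have ex_l : exists l, (0 < l) && (alpha (n1 + l) == alpha n1).
  by exists (n' - n1); rewrite subn_gt0 lt_n1n' subnKC ?eq_n1n' ?eqxx // ltnW.
case: (ex_minnP ex_l) => l /andP[l_gt0 /eqP eq_l] l_min.
have per : periodic n1 l alpha.
  move=> n le_n1n; have := shift (n - n1) _ _ eq_l.
  by rewrite addnAC subnKC.
(* Shifting by [l - i] turns [alpha (n1 + i)] into [alpha (n1 + l) = alpha n1]. If [j < i], then
   [j + (l - i)] is positive, below [l], and contradicts [l_min]. *)
have inj_window i j : j <= i < l -> alpha (n1 + i) = alpha (n1 + j) -> i = j.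
  case/andP=> le_ji lt_il /(shift (l - i)).
  rewrite -!addnA subnKC 1?ltnW // eq_l => eq_d.
  have [lt_ji|le_ij] := ltnP j i; last by apply/eqP; rewrite eqn_leq le_ij.
  have := l_min (j + (l - i)); rewrite -eq_d eqxx andbT; lia.
have eqmod m n : n1 <= m -> n1 <= n -> alpha m = alpha n -> m = n %[mod l].
  move=> le_m le_n; rewrite (periodic_reduce per) // [RHS](periodic_reduce per) //.
  move=> eq_a; rewrite -(subnKC le_m) -(subnKC le_n).
  apply/eqP; rewrite eqn_modDl; apply/eqP.
  have [le|/ltnW le] := leqP ((m - n1) %% l) ((n - n1) %% l).
    by symmetry; apply: inj_window; rewrite ?le ?ltn_pmod.
  by apply: inj_window; rewrite ?le ?ltn_pmod.
exists n1, l; split=> //; split=> // n.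
  (* If [n] and [alpha n] differ, the smaller one collapses while lying below [n1], against
     minimality. *)
  move=> lt_n; case: (ltngtP n (alpha n)) => // lt.
    have /n1_min : collapses n by exists (alpha n).
    lia.
  have /n1_min : collapses (alpha n) by exists n.
  lia.
case/andP=> le_n lt_n.
have le_a : n1 <= alpha n.
  have [le|lt] := leqP n (alpha n); first exact: leq_trans le.
  by apply: n1_min; exists n.
have eq_a := eqmod _ _ le_a le_n (idem n); split=> //.
(* Otherwise both lie in one window of length [l], so [n - alpha n] is positive and below [l], hence
   not a multiple of [l]. *)
rewrite leqNgt; apply/negP => lt.
have : l %| n - alpha n by rewrite -eqn_mod_dvd 1?ltnW // eq_a.
by rewrite gtnNdvd ?subn_gt0 //; lia.
Qed.

Theorem proposition4p7 (alpha : nat -> nat) :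
  (idempotent_shift_stable alpha <->
     is_identity alpha \/
     exists n1 l : nat, 0 < l /\ conditions_abc n1 l alpha)
  /\
  (idempotent_shift_stable alpha ->
     ((forall n : nat, alpha n = 0 <-> n = 0) <->
        is_identity alpha \/
        exists n1 l : nat, [/\ 0 < n1, 0 < l & conditions_abc n1 l alpha])).
Proof.
have necessary : idempotent_shift_stable alpha ->
    is_identity alpha \/ exists n1 l : nat, 0 < l /\ conditions_abc n1 l alpha.
  have [id_a|nid] := classic (is_identity alpha); first by left.
  by right; apply: idempotent_shift_stable_abc.
split.
  split=> // -[id_a n n' k|[n1 [l [l_gt0 abc]]]].
    by rewrite !id_a; split=> // ->.
  exact: abc_idempotent_shift_stable abc.
move=> stable; split=> [eq0|[id_a n|[n1 [l [n1_gt0 l_gt0 abc]]]]].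
- have [id_a|[[|n1] [l [l_gt0 abc]]]] := necessary stable; first by left.
    (* With index 0, periodicity gives [alpha l = alpha 0 = 0], hence [l = 0], a contradiction. *)
    have [_ per _] := abc; have a0 : alpha 0 = 0 by apply/eq0.
    have /eq0 l0 : alpha l = 0 by rewrite -[l]add0n -per.
    by rewrite l0 in l_gt0.
  by right; exists n1.+1, l.
- by rewrite id_a.
- exact: abc_eq0 abc n1_gt0.
Qed.
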